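(* Let $G$ be a quadrangulation with minimum degree $\delta(G) \ge 3$. Then $\overrightarrow{\chi}(G) = 3$ unless $G$ is isomorphic to the $3$-cube $Q_3$. If $G$ is isomorphic to $Q_3$, then $\overrightarrow{\chi}(G) = 2$.
   Context: All graphs are finite and simple, with at least one vertex. A quadrangulation is a bipartite planar graph (embedded in the plane) each of whose faces, including the outer face, is bounded by a $4$-cycle. The $3$-cube $Q_3$ is the graph on $\{0,1\}^3$ in which two vertices are adjacent if and only if they differ in exactly one coordinate. An orientation $\sigma$ of $G$ is a digraph obtained from $G$ by replacing each edge by exactly one of the two possible arcs with the same end-vertices. For $v \in V(G)$, the indegree $d^-_{\sigma}(v)$ is the number of arcs of $\sigma$ incoming to $v$. A $k$-orientation is an orientation in which every vertex has indegree at most $k$. An orientation $\sigma$ is proper if $d^-_{\sigma}(u) \ne d^-_{\sigma}(v)$ for every edge $uv \in E(G)$. The proper orientation number $\overrightarrow{\chi}(G)$ is the minimum integer $k$ such that $G$ admits a proper $k$-orientation. *)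

(* Defs.v *)
From mathcomp Require Import all_boot all_fingroup.
Set Implicit Arguments.
Unset Strict Implicit.
Unset Printing Implicit Defensive.

Record sgraph := SGraph {
  vertex :> finType;
  adj : rel vertex;
  adj_sym : symmetric adj;
  adj_irr : irreflexive adj;
  vertex_gt0 : 0 < #|vertex|
}.

Section Graphs.
Variable G : sgraph.
Implicit Types (u v : G) (o : {set G * G}).

Definition degree v := #|[set u | adj u v]|.

(* A degree is less than #|G|, and G has a vertex, so that the initial value
   #|G| does not affect the minimum. *)
Definition min_degree := \big[minn/#|G|]_(v : G) degree v.

Definition connected := forall u v, connect (@adj G) u v.

Definition bipartite := exists c : G -> bool, forall u v, adj u v -> c u != c v.

(* An orientation is given by its set of arcs, (u, v) being the arc from u
   to v. *)
Definition is_orientation o :=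
  [forall u, forall v,
    if adj u v then ((u, v) \in o) (+) ((v, u) \in o) else (u, v) \notin o].

Definition indegree o v := #|[set u | (u, v) \in o]|.

Definition is_k_orientation k o :=
  is_orientation o && [forall v, indegree o v <= k].

Definition is_proper o :=
  [forall u, forall v, adj u v ==> (indegree o u != indegree o v)].

Definition has_proper_orientation k :=
  [exists o : {set G * G}, is_k_orientation k o && is_proper o].

(* Peel off a vertex v of maximum degree in the subgraph induced by S and
   orient all its remaining edges towards v. *)
Lemma proper_orientation_on (S : {set G}) : exists o : {set G * G},
  [/\ forall u v, (u, v) \in o -> [&& u \in S, v \in S & adj u v],
      forall u v, u \in S -> v \in S -> adj u v ->
        ((u, v) \in o) (+) ((v, u) \in o)
    & forall u v, u \in S -> v \in S -> adj u v ->
        indegree o u != indegree o v].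
Proof.
have [n leSn] := ubnP #|S|; elim: n => // n IHn in S leSn *.
have [->|[v0 v0S]] := set_0Vmem S.
  by exists set0; split=> u v; rewrite inE.
pose dg v := #|[set u in S | adj u v]|.
have [v vS0 vmax] := arg_maxnP dg v0S; have {vS0} vS : v \in S by [].
have [|o' [sub' tot' prop']] := IHn (S :\ v).
  by move: leSn; rewrite (cardsD1 v S) vS.
pose o := o' :|: [set p | [&& p.2 == v, p.1 \in S & adj p.1 v]].
have inv u : ((u, v) \in o) = (u \in S) && adj u v.
  rewrite !inE /= eqxx /=; case uv: ((u, v) \in o') => //.
  by have := sub' _ _ uv; rewrite !inE eqxx /= andbF.
have inw u w : w != v -> ((u, w) \in o) = ((u, w) \in o').
  by move=> /negbTE wv; rewrite !inE /= wv orbF.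
have outv w : ((v, w) \in o) = false.
  rewrite !inE /=; case vw: ((v, w) \in o').
    by have := sub' _ _ vw; rewrite !inE eqxx.
  by rewrite adj_irr !andbF.
have dv : indegree o v = dg v.
  by apply: eq_card => u; rewrite [LHS]inE [RHS]inE inv.
have dw w : w != v -> indegree o w = indegree o' w.
  by move=> wv; apply: eq_card => u; rewrite [LHS]inE [RHS]inE inw.
have lt_dv u : u \in S -> adj u v -> indegree o u < indegree o v.
  move=> uS uv; have uv' : u != v by apply: contraTneq uv => ->; rewrite adj_irr.
  rewrite dv (leq_trans _ (vmax _ uS)) // dw //.
  apply/proper_card/properP; split.
    apply/subsetP => w; rewrite !inE => /sub'; rewrite !inE.
    by case/and3P=> /andP[_ ->].
  exists v; rewrite inE ?vS 1?adj_sym //.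
  by apply/negP => /sub'; rewrite !inE eqxx.
exists o; split=> [u w|u w uS wS uw|u w uS wS uw].
- have [->|wv] := eqVneq w v; first by rewrite inv => /andP[-> ->]; rewrite vS.
  by rewrite inw // => /sub'; rewrite !inE => /and3P[/andP[_ ->] /andP[_ ->] ->].
- have [wv|wv] := eqVneq w v; first by rewrite wv inv outv uS -wv uw.
  have [uv|uv] := eqVneq u v; first by rewrite uv inv outv wS adj_sym -uv uw.
  by rewrite !inw //; apply: tot'; rewrite ?inE ?uv ?wv.
- have [wv|wv] := eqVneq w v; first by rewrite wv neq_ltn lt_dv // -wv.
  have [uv|uv] := eqVneq u v.
    by rewrite uv neq_ltn lt_dv ?orbT // -uv adj_sym.
  by rewrite !dw //; apply: prop'; rewrite ?inE ?uv ?wv.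
Qed.

Lemma exists_proper_orientation : exists k, has_proper_orientation k.
Proof.
have [o [sub tot prop]] := proper_orientation_on [set: G].
exists #|G|; apply/existsP; exists o; apply/andP; split.
  apply/andP; split; last by apply/forallP => v; apply: max_card.
  apply/forallP => u; apply/forallP => v; case: ifP => uv.
    by apply: tot; rewrite ?inE.
  by apply/negP => /sub; rewrite uv !andbF.
by apply/forallP => u; apply/forallP => v; apply/implyP; apply: prop; rewrite inE.
Qed.

Definition proper_orientation_number := ex_minn exists_proper_orientation.

(* Plane embeddings are represented by combinatorial maps. A dart (u, v) is the
   edge uv directed from u to v; a rotation system permutes cyclically the darts
   leaving each vertex. *)
Definition dart := {p : G * G | adj p.1 p.2}.

Definition tail (d : dart) : G := (val d).1.

Fact rev_dart_subproof (d : dart) : adj (val d).2 (val d).1.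
Proof. by rewrite adj_sym (valP d). Qed.

Definition rev_dart (d : dart) : dart :=
  exist (fun p : G * G => adj p.1 p.2) ((val d).2, (val d).1)
    (rev_dart_subproof d).

Lemma rev_dartK : involutive rev_dart.
Proof. by move=> [[u v] uv]; apply: val_inj. Qed.

Definition dart_rev : {perm dart} := perm (inv_inj rev_dartK).

Definition is_rotation_system (rho : {perm dart}) :=
  forall d, porbit rho d = [set d' | tail d' == tail d].

(* From (u, v), the face permutation goes to the dart that follows (v, u) in the
   rotation at v; its orbits are the facial walks. *)
Definition face_perm (rho : {perm dart}) : {perm dart} := (dart_rev * rho)%g.

(* For a connected graph with at least one edge, the rotation system is that of
   an embedding in the plane if and only if it has Euler characteristic 2; the
   orbits of dart_rev are the edges. *)
Definition is_plane_embedding (rho : {perm dart}) :=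
  is_rotation_system rho /\
  #|G| + #|porbits (face_perm rho)| = #|porbits dart_rev| + 2.

Definition face_is_4cycle (f : {set dart}) :=
  #|f| = 4 /\ {in f &, injective tail}.

(* Connectedness is implied by each face being bounded by a single cycle; it is
   explicit because facial walks alone do not determine the faces of a
   disconnected plane graph. *)
Definition quadrangulation :=
  [/\ bipartite, connected
    & exists2 rho : {perm dart}, is_plane_embedding rho
      & forall f, f \in porbits (face_perm rho) -> face_is_4cycle f].

End Graphs.

Definition isomorphic (G H : sgraph) :=
  exists2 f : G -> H, bijective f & forall u v, adj (f u) (f v) = adj u v.

Definition cube_adj : rel {ffun 'I_3 -> bool} :=
  fun x y => #|[set i | x i != y i]| == 1.

Fact cube_adj_sym : symmetric cube_adj.
Proof.
by move=> x y; congr (_ == _); apply: eq_card => i; rewrite !inE eq_sym.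
Qed.

Fact cube_adj_irr : irreflexive cube_adj.
Proof.
by move=> x; rewrite /cube_adj eq_card0 // => i; rewrite !inE eqxx.
Qed.

Fact cube_gt0 : 0 < #|{ffun 'I_3 -> bool}|.
Proof. by rewrite card_ffun card_bool expn_gt0. Qed.

Definition Q3 : sgraph := SGraph cube_adj_sym cube_adj_irr cube_gt0.

(* Main.v *)
Require Import Defs.
From mathcomp Require Import all_boot all_fingroup all_algebra zify.

(** Write n, e and f for the numbers of vertices, edges and faces of the
    quadrangulation G; Euler's formula and 2e = 4f give e = 2n - 4.

    Upper bound.  Only three facts about G matter: it is bipartite, it has
    minimum degree at least 3, and it has a 2-orientation.  Given a
    2-orientation, pick a colour class A and, for each a in A, reverse arcs
    leaving a until a has indegree exactly 3, which is possible because a has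
    degree at least 3.  As A is independent, the reversals at different vertices
    of A do not interfere, and they only decrease the indegrees in the other
    class B, so that these stay at most 2: the result is a proper 3-orientation
    ([proper_orientation_of_bipartite]).

    A 2-orientation exists as soon as every vertex set S spans at most 2|S|
    edges ([orientation_of_sparse], Hakimi's theorem, proved by reversing
    directed paths).  For a plane bipartite graph this sparsity is the usual
    consequence of Euler's formula applied to the subgraph spanned by S.  To
    avoid building an embedding of that subgraph, the relevant inequality is
    obtained by linear algebra in the given embedding of G.  Let C be the set of
    edges not inside S.  Functions on C which are differences of vertex
    potentials vanishing on S are orthogonal to those which are differences of
    face potentials, because going around a face the differences of a vertex
    potential cancel out.  The former make a space of dimension n - |S|.  The
    latter make a space of dimension f - r, where r is the number of classes
    into which the faces fall when they are merged across the edges of C (these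
    are the faces of the subgraph spanned by S).  Hence
    |C| >= (n - |S|) + (f - r) ([card_outside]).  If r > 1, each class has a
    boundary which contains a cycle of a bipartite graph, hence at least four
    edges, all inside S ([card_classes]).  With n + f = e + 2, these two facts
    bound the number of edges inside S ([sparse_bipartite_plane]).

    Lower bound.  In a 2-orientation the indegrees sum to 2n - 4, so at most
    four vertices have indegree below 2.  If the orientation is proper, the set
    I of the other vertices is independent, so its vertices send at least
    3(n - 4) edges to the complement of I, which forces n <= 8; the minimum
    degree forces n >= 8.  So n = 8, all these inequalities are equalities, and
    G is cubic and bipartite with two classes of size 4: it is K_{4,4} minus a
    perfect matching, which is the cube ([cube_of_proper_2_orientation],
    [cube_of_cubic_4_4]).  The cube itself has an explicit proper
    2-orientation, and no 1-orientation as it has more edges than vertices. *)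

Set Implicit Arguments.
Unset Strict Implicit.
Unset Printing Implicit Defensive.

Import GRing.Theory.

(** * Orientations with bounded indegrees *)

Section Orientations.
Variable G : sgraph.
Implicit Types (u v w : G) (o : {set G * G}) (S : {set G}).

Definition arcs_in S :=
  [set p : G * G | [&& p.1 \in S, p.2 \in S & adj p.1 p.2]].

Lemma arc_adj o u v : is_orientation o -> (u, v) \in o -> adj u v.
Proof. by move/forallP/(_ u)/forallP/(_ v); case: adj => // /negbTE->. Qed.

Lemma arc_rev o u v :
  is_orientation o -> adj u v -> ((v, u) \in o) = ((u, v) \notin o).
Proof.
by move/forallP/(_ u)/forallP/(_ v) => + uv; rewrite uv; do 2!case: in_mem.
Qed.

Lemma indegreeE o v : indegree o v = \sum_(u : G) ((u, v) \in o).
Proof.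
rewrite /indegree -sum1dep_card big_mkcond /=.
by apply: eq_bigr => u _; case: in_mem.
Qed.

Lemma degreeE v : degree v = \sum_(u : G) adj u v.
Proof.
rewrite /degree -sum1dep_card big_mkcond /=.
by apply: eq_bigr => u _; case: adj.
Qed.

Lemma min_degreeP k : k <= min_degree G -> forall v, k <= degree v.
Proof.
move=> le_k v; apply: leq_trans le_k _; rewrite /min_degree.
elim: (index_enum G) (mem_index_enum v) => // w s IHs.
rewrite inE big_cons; case/orP => [/eqP <-|/IHs le_s]; first exact: geq_minl.
exact: leq_trans (geq_minr _ _) le_s.
Qed.

Lemma sum_degree_in S :
  \sum_(v in S) \sum_(u in S) adj u v = #|arcs_in S|.
Proof.
rewrite exchange_big pair_big /= /arcs_in -sum1dep_card big_mkcond
  [RHS]big_mkcond /=.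
by apply: eq_bigr => -[u v] _ /=; rewrite andbA; case: ifP; case: adj.
Qed.

Lemma sum_degree : \sum_(v : G) degree v = #|arcs_in setT|.
Proof.
rewrite -sum_degree_in; apply: eq_big => v; first by rewrite inE.
by move=> _; rewrite degreeE; apply: eq_bigl => u; rewrite inE.
Qed.

Lemma card_arcs_in_orientation o S : is_orientation o ->
  #|arcs_in S| = 2 * #|[set p in o | (p.1 \in S) && (p.2 \in S)]|.
Proof.
move=> ori; set X := [set p in o | _].
pose sw (p : G * G) := (p.2, p.1).
have sw_inj : injective sw by move=> [a b] [c d] [-> ->].
have -> : arcs_in S = X :|: sw @^-1: X.
  apply/setP => -[u v]; rewrite !inE /=.
  case uv: (adj u v); first by rewrite (arc_rev ori uv); do 3!case: in_mem.
  rewrite !andbF; apply/esym/negP; case/orP=> /andP[/(arc_adj ori)].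
    by rewrite uv.
  by rewrite adj_sym uv.
rewrite cardsU card_preimset // (_ : X :&: _ = set0) ?cards0 ?subn0 ?addnn
  ?mul2n //.
apply/setP => -[u v]; rewrite !inE /=; apply/negP.
case/andP=> /andP[uv _] /andP[vu _].
by have := arc_rev ori (arc_adj ori uv); rewrite vu uv.
Qed.

Lemma sum_indegree o : is_orientation o ->
  2 * \sum_(v : G) indegree o v = #|arcs_in setT|.
Proof.
move=> ori; rewrite (card_arcs_in_orientation _ ori); congr (2 * _).
rewrite (eq_bigr _ (fun v _ => indegreeE o v)) exchange_big pair_big /=.
rewrite -sum1dep_card [RHS]big_mkcond /=; apply: eq_bigr => -[u v] _ /=.
by rewrite !inE !andbT; case: in_mem.
Qed.

Definition flip_arc o u v := (v, u) |: o :\ (u, v).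

Lemma flip_arc_in o u v x y :
  is_orientation o -> (u, v) \in o ->
  ((x, y) \in flip_arc o u v) =
    if (x == u) && (y == v) then false
    else if (x == v) && (y == u) then true else (x, y) \in o.
Proof.
move=> ori uv; have nvu : u != v.
  by apply: contraTneq (arc_adj ori uv) => ->; rewrite adj_irr.
rewrite !inE !xpair_eqE.
case: (eqVneq x u) => [->|//]; rewrite ?(negbTE nvu) //=.
by case: eqVneq => //.
Qed.

Lemma flip_arc_orientation o u v :
  is_orientation o -> (u, v) \in o -> is_orientation (flip_arc o u v).
Proof.
move=> ori uv; have auv := arc_adj ori uv.
have nvu : u != v by apply: contraTneq auv => ->; rewrite adj_irr.
apply/forallP => x; apply/forallP => y; have := ori.
move/forallP/(_ x)/forallP/(_ y); rewrite !flip_arc_in //.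
have [->|xu] := eqVneq x u; have [->|yv] := eqVneq y v => //=.
- by rewrite auv (negbTE nvu) andbF.
- by rewrite (negbTE nvu) andbF.
- by rewrite [v == u]eq_sym (negbTE nvu) andbF.
have [->|xv] := eqVneq x v; have [->|yu] := eqVneq y u => //=.
by rewrite adj_sym auv.
Qed.

Lemma indegree_flip_arc o u v x :
  is_orientation o -> (u, v) \in o ->
  indegree (flip_arc o u v) x + (x == v) = indegree o x + (x == u).
Proof.
move=> ori uv; have nvu : u != v.
  by apply: contraTneq (arc_adj ori uv) => ->; rewrite adj_irr.
have vu : (v, u) \notin o.
  by rewrite -(arc_rev ori) ?negbK // adj_sym (arc_adj ori).
rewrite !indegreeE; have [->|xv] := eqVneq x v.
  rewrite (bigD1 u) // [in RHS](bigD1 u) //= flip_arc_in // !eqxx uv.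
  rewrite [v == u]eq_sym (negbTE nvu) /= addn0 add0n addn1 add1n; congr _.+1.
  by apply: eq_bigr => y yu; rewrite flip_arc_in // (negbTE yu) [v == u]eq_sym
    (negbTE nvu) andbF.
have [->|xu] := eqVneq x u.
  rewrite (bigD1 v) // [in RHS](bigD1 v) //= flip_arc_in // !eqxx (negbTE vu).
  rewrite (negbTE nvu) andbF /= addn0 add0n addn1 add1n; congr _.+1.
  by apply: eq_bigr => y yu; rewrite flip_arc_in // (negbTE yu) (negbTE nvu)
    andbF.
by congr (_ + _); apply: eq_bigr => y _;
  rewrite flip_arc_in // (negbTE xv) (negbTE xu) !andbF.
Qed.

(** Reversing a directed path moves one unit of indegree from its end to its
    start.  Simplicity of the path keeps its remaining arcs intact when the
    first one is reversed. *)
Lemma flip_path o u p :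
  is_orientation o -> path (fun x y => (x, y) \in o) u p -> uniq (u :: p) ->
  exists2 o', is_orientation o' &
    forall x, indegree o' x + (x == last u p) = indegree o x + (x == u).
Proof.
elim: p o u => [|w p IHp] o u ori /=; first by exists o.
case/andP=> uw wp /andP[]; rewrite inE negb_or => /andP[nuw up] /andP[wNp pU].
have [||o' ori' deg'] := IHp _ w (flip_arc_orientation ori uw); last 1 first.
- exists o' => // x; have := indegree_flip_arc x ori uw; have := deg' x; lia.
- apply: (sub_in_path (P := predC1 u)) wp => [x y /= xu yu xy|].
    rewrite flip_arc_in // (negbTE xu) (negbTE yu) andbF //.
  by apply/allP => x; apply: contraTneq => ->; rewrite inE negb_or nuw.
- by rewrite /= wNp.
Qed.

Lemma orientation_exists : exists o, is_orientation o.
Proof.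
by have [k /existsP[o /andP[/andP[ori _] _]]] := exists_proper_orientation G;
  exists o.
Qed.

(** Hakimi's theorem; [arcs_in] counts every edge twice.  Take an orientation
    with the least total excess of indegrees over k, a vertex v of indegree
    greater than k, and the set S of vertices from which v can be reached.  If S
    had a vertex of indegree less than k, reversing a path from it to v would
    decrease the excess.  So the indegrees in S are at least k, one of them
    being greater, and as all arcs entering S come from S, too many edges are
    inside S. *)
Lemma orientation_of_sparse k : (forall S, #|arcs_in S| <= 2 * (k * #|S|)) ->
  exists o, is_k_orientation k o.
Proof.
move=> sparse; have [o0 ori0] := orientation_exists.
pose excess o := \sum_(v : G) (indegree o v - k).
have [o ori min_o] := arg_minnP excess ori0.
exists o; rewrite /is_k_orientation ori; apply/forallP => v; rewrite leqNgt.
apply/negP => lt_kv.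
pose e := [rel x y : G | (x, y) \in o].
pose S := [set u | connect e u v].
have le_kS u : u \in S -> k <= indegree o u.
  rewrite inE => /connectP[p ep ev]; rewrite leqNgt; apply/negP => lt_uk.
  have [q [oq uq eqv]] : exists q,
      [/\ path e u q, uniq (u :: q) & last u q = v].
    by rewrite ev; have [q oq uq _] := shortenP ep; exists q.
  have [o' ori' deg'] := flip_path ori oq uq.
  have := min_o _ ori'; rewrite leqNgt => /negP; apply.
  have nuv : u != v by apply: contraTneq lt_kv => <-; rewrite -leqNgt ltnW.
  rewrite /excess (bigD1 v) // [in X in _ < X](bigD1 v) //= -addSn leq_add //.
    have := deg' v; rewrite eqv eqxx eq_sym (negbTE nuv); lia.
  apply: leq_sum => x xv; have := deg' x; rewrite eqv (negbTE xv).
  by case: eqP => [->|]; lia.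
have vS : v \in S by rewrite inE.
have := sparse S; rewrite (card_arcs_in_orientation _ ori) leq_pmul2l //.
apply/negP; rewrite -ltnNge mulnC -sum_nat_const.
have -> : #|[set p in o | (p.1 \in S) && (p.2 \in S)]| =
          \sum_(x in S) indegree o x.
  rewrite (eq_bigr _ (fun x _ => indegreeE o x)) exchange_big pair_big /=.
  rewrite -sum1dep_card big_mkcond [RHS]big_mkcond /=;
    apply: eq_bigr => -[x y] _ /=.
  case xy: ((x, y) \in o); last by rewrite if_same.
  have [yS|] := boolP (y \in S); last by rewrite andbF.
  suff -> : x \in S by [].
  by move: yS; rewrite !inE; apply: connect_trans; apply: connect1.
rewrite (bigD1 v) // [in X in _ < X](bigD1 v) //= -addSn leq_add //.
by apply: leq_sum => x /andP[/le_kS].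
Qed.

Lemma subset_of_card_between (T : finType) (A B : {set T}) m :
  A \subset B -> #|A| <= m <= #|B| ->
  exists X : {set T}, [/\ A \subset X, X \subset B & #|X| = m].
Proof.
move=> sAB /andP[]; elim: m => [|m IHm] leA leB.
  by exists A; split=> //; apply/eqP; rewrite eqn_leq leA.
have [->|neq] := eqVneq m.+1 #|A|; first by exists A.
have [|X [sAX sXB cX]] := IHm _ (ltnW leB).
  by rewrite -ltnS ltn_neqAle eq_sym neq.
have /properP[_ [x xB xX]] : X \proper B by rewrite properEcard sXB cX.
exists (x |: X); split; last by rewrite cardsU1 xX cX.
- exact: subset_trans sAX (subsetUr _ _).
- by rewrite subUset sub1set xB.
Qed.

(** In the colour class where c is true, every vertex v has its in-neighbourhood
    enlarged to a set X v of exactly k + 1 neighbours.  This only takes arcs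
    away from the other class, where the indegrees remain at most k. *)
Lemma proper_orientation_of_bipartite k :
  bipartite G -> k < min_degree G -> (exists o, is_k_orientation k o) ->
  has_proper_orientation G k.+1.
Proof.
move=> [c cP] mindeg [o /andP[ori /forallP le_k]].
have /fin_all_exists[X XP] v : exists X : {set G},
    [/\ [set u | (u, v) \in o] \subset X,
      X \subset [set u | adj u v] & #|X| = k.+1].
  apply: subset_of_card_between.
    by apply/subsetP => u; rewrite !inE; apply: arc_adj.
  by rewrite (leqW (le_k v)) (min_degreeP mindeg).
have oX u v : (u, v) \in o -> u \in X v.
  by move=> uv; have [/subsetP/(_ u) + _ _] := XP v; rewrite inE; apply.
have adjX u v : u \in X v -> adj u v.
  by have [_ /subsetP/(_ u) + _] := XP v; rewrite inE; apply.
pose o' := [set p : G * G | adj p.1 p.2 &&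
  (if c p.2 then p.1 \in X p.2 else p.2 \notin X p.1)].
have degT v : c v -> indegree o' v = k.+1.
  move=> cv; have [_ _ <-] := XP v; apply: eq_card => u; rewrite !inE /= cv.
  by apply: andb_idl; apply: adjX.
have degF v : ~~ c v -> indegree o' v <= k.
  move=> /negbTE cv; apply: leq_trans (le_k v); apply: subset_leq_card.
  apply/subsetP => u; rewrite !inE /= cv => /andP[uv]; apply: contraR => nuv.
  by apply: oX; rewrite (arc_rev ori uv).
apply/existsP; exists o'; apply/andP; split; first apply/andP; first split.
- apply/forallP => u; apply/forallP => v; rewrite !inE /= [adj v u]adj_sym.
  case uv: (adj u v) => //=; have := cP _ _ uv.
  by case: (c u); case: (c v) => //= _; [rewrite addNb|rewrite addbN];
    rewrite addbb.
- apply/forallP => v; case: (boolP (c v)) => [/degT->//|/degF]; exact: leqW.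
- apply/forallP => u; apply/forallP => v; apply/implyP => uv; have := cP _ _ uv.
  case: (boolP (c u)) => [/degT->|/degF du];
    case: (boolP (c v)) => [/degT->|/degF dv] //= _.
    by rewrite gtn_eqF.
  by rewrite ltn_eqF.
Qed.

End Orientations.

(** * Linear algebra and permutations *)

(** Two linearly independent families of functions on C which are orthogonal to
    each other have together at most |C| members.  A linear combination is
    given by coefficients on the whole index type that vanish outside of the
    index set, so that the sums need no restriction. *)
Lemma free_families_le (F : fieldType) (I J E : finType)
    (A : {set I}) (B : {set J}) (C : {set E})
    (p : I -> E -> F) (q : J -> E -> F) :
    (forall x : I -> F, (forall i, i \notin A -> x i = 0%R) ->
      (forall e, e \in C -> (\sum_i x i * p i e)%R = 0%R) ->
      forall i, x i = 0%R) ->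
    (forall y : J -> F, (forall j, j \notin B -> y j = 0%R) ->
      (forall e, e \in C -> (\sum_j y j * q j e)%R = 0%R) ->
      forall j, y j = 0%R) ->
    (forall i j, i \in A -> j \in B -> (\sum_(e in C) p i e * q j e)%R = 0%R) ->
  #|A| + #|B| <= #|C|.
Proof.
move=> freep freeq orth.
pose Mx (K : finType) (D : {set K}) (r : K -> E -> F) : 'M[F]_(#|D|, #|C|) :=
  (\matrix_(i, j) r (enum_val i) (enum_val j))%R.
have row_freeMx (K : finType) (D : {set K}) (r : K -> E -> F) :
    (forall x : K -> F, (forall i, i \notin D -> x i = 0%R) ->
      (forall e, e \in C -> (\sum_i x i * r i e)%R = 0%R) ->
      forall i, x i = 0%R) ->
    row_free (Mx K D r).
  move=> freer; apply: inj_row_free => v vM.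
  pose x i : F := (\sum_k v ord0 k *+ (enum_val k == i))%R.
  have x_val k : x (enum_val k) = v ord0 k.
    rewrite /x (bigD1 k) //= eqxx big1 ?addr0 // => l /negbTE nlk.
    by rewrite (inj_eq enum_val_inj) nlk.
  have x_out i : i \notin D -> x i = 0%R.
    move=> iD; rewrite /x big1 // => k _; case: eqP => // ki.
    by rewrite -ki enum_valP in iD.
  apply/rowP => k; rewrite mxE -x_val; apply: freer => // e eC.
  have := congr1 (fun M : 'rV_#|C| => M ord0 (enum_rank_in eC e)) vM.
  rewrite !mxE; apply: etrans; rewrite (bigID [in D]) /= [X in (_ + X)%R]big1
    ?addr0.
    by rewrite big_enum_val; apply: eq_bigr => l _;
      rewrite x_val mxE enum_rankK_in.
  by move=> i iD; rewrite x_out // mul0r.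
have := row_freeMx _ _ _ freep; have := row_freeMx _ _ _ freeq.
move=> /eqP <- /eqP <-; rewrite -[X in _ + X <= _]mxrank_tr mulmx0_rank_max //.
apply/matrixP => i j; rewrite !mxE -[RHS](orth _ _ (enum_valP i) (enum_valP j)).
by rewrite [RHS]big_enum_val; apply: eq_bigr => k _; rewrite !mxE.
Qed.

Lemma connect_invariant (T : finType) (U : Type) (e : rel T) (f : T -> U) :
  (forall x y, e x y -> f x = f y) -> forall x y, connect e x y -> f x = f y.
Proof.
move=> inv x y /connectP[p]; elim: p x => [|z p IHp] x /=; first by move=> _ ->.
by case/andP=> /inv -> zp /(IHp _ zp).
Qed.

Lemma card_porbits_uniform (T : finType) (s : {perm T}) k :
  (forall f, f \in porbits s -> #|f| = k) -> #|T| = #|porbits s| * k.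
Proof.
move=> cardf; rewrite -cardsT -sum1_card -sum_nat_const.
rewrite (partition_big (porbit s) (mem (porbits s))) /=; last first.
  by move=> x _; apply: imset_f.
apply: eq_bigr => f fs; rewrite -(cardf _ fs) -sum1_card; apply: eq_bigl => x.
have /imsetP[y _ ->] := fs.
by rewrite inE eq_porbit_mem.
Qed.

(** * Sparsity of plane bipartite graphs *)

Section PlaneMaps.
Variable G : sgraph.
Implicit Types (d : dart G) (S : {set G}).

Lemma adj_dart (u v : G) : adj u v ->
  exists2 d, tail d = u & tail (rev_dart d) = v.
Proof.
by move=> uv; exists (exist (fun p : G * G => adj p.1 p.2) (u, v) uv).
Qed.

Lemma dart_adj d : adj (tail d) (tail (rev_dart d)).
Proof. exact: valP d. Qed.

Lemma dart_eq d d' :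
  tail d = tail d' -> tail (rev_dart d) = tail (rev_dart d') -> d = d'.
Proof.
case: d d' => [[u v] uv] [[u' v'] uv'] /= tt hh.
by apply: val_inj; congr (_, _).
Qed.

Definition darts_in S := [set d | (tail d \in S) && (tail (rev_dart d) \in S)].

Lemma card_darts_in S : #|darts_in S| = #|arcs_in S|.
Proof.
rewrite -(card_imset _ val_inj); congr #|pred_of_set _|; apply/setP => -[u v].
apply/imsetP/idP => [[[[x y] /= xy]]|].
  by rewrite !inE => /andP[xS yS] [-> ->]; apply/and3P.
rewrite inE => /and3P[/= uS vS uv].
by exists (exist (fun p : G * G => adj p.1 p.2) (u, v) uv); rewrite // inE;
  apply/andP.
Qed.

Lemma card_dart : #|{: dart G}| = #|arcs_in [set: G]|.
Proof. by rewrite -card_darts_in; apply: eq_card => d; rewrite !inE. Qed.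

Lemma card_dart_edges : #|{: dart G}| = #|porbits (dart_rev G)| * 2.
Proof.
apply: card_porbits_uniform => f /imsetP[d _ ->].
suff -> : porbit (dart_rev G) d = [set d; rev_dart d].
  rewrite cards2; case: eqP => // dd.
  by have := dart_adj d; rewrite -dd adj_irr.
apply/setP => d'; rewrite !inE; apply/porbitP/orP => [[i ->]|[]/eqP->].
- elim: i => [|i IHi]; first by rewrite perm1; left.
  rewrite expgSr permM permE; case: IHi => /eqP->; first by right.
  by rewrite rev_dartK; left.
- by exists 0; rewrite perm1.
- by exists 1; rewrite permE.
Qed.

Section Rotation.
Variables (rho : {perm dart G}) (c : G -> bool).
Hypothesis conG : connected G.
Hypothesis rotG : is_rotation_system rho.
Hypothesis colG : forall u v : G, adj u v -> c u != c v.
Local Notation phi := (face_perm rho).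

Lemma face_permE d : phi d = rho (rev_dart d).
Proof. by rewrite permM permE. Qed.

Lemma tail_face_perm d : tail (phi d) = tail (rev_dart d).
Proof.
have := mem_porbit rho 1 (rev_dart d); rewrite rotG inE => /eqP.
by rewrite face_permE.
Qed.

Lemma color_rev d : c (tail (rev_dart d)) = ~~ c (tail d).
Proof. by have := colG (dart_adj d); case: c; case: c. Qed.

(** Each edge is represented by its dart which leaves a vertex of colour true.
    This replaces the choice of a reference orientation. *)
Lemma big_rev_color (R : Type) (idx : R) (op : Monoid.com_law idx)
    (W : {set dart G}) (u : dart G -> R) :
    (forall d, (rev_dart d \in W) = (d \in W)) ->
  \big[op/idx]_(d in W) u d =
  \big[op/idx]_(d in [set d in W | c (tail d)]) op (u d) (u (rev_dart d)).
Proof.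
move=> revW; rewrite big_split (bigID (fun d => c (tail d))) /=; congr (op _ _).
  by apply: eq_bigl => d; rewrite inE.
rewrite (reindex_inj (inv_inj (@rev_dartK G))) /=; apply: eq_bigl => d.
by rewrite inE revW color_rev negbK.
Qed.

(** In this section K, being stable under the face permutation, is the set of
    darts on a union of faces, and bd consists of the boundary darts of this
    region. *)
Section Boundary.
Variable K : {set dart G}.
Hypothesis phiK : forall d, (phi d \in K) = (d \in K).
Let bd := [set d in K | rev_dart d \notin K].

(** A region without boundary is stable under reversal, thus also under the
    rotation, and it is everything as G is connected. *)
Lemma boundary_neq0 d1 d2 : d1 \in K -> d2 \notin K -> exists d, d \in bd.
Proof.
move=> d1K d2K; apply/set0Pn; apply: contraNneq d2K => bd0.
have revK d : d \in K -> rev_dart d \in K.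
  move=> dK; apply: contraT => rdK.
  by have : d \in bd by [rewrite inE dK]; rewrite bd0 inE.
have rhoK d : d \in K -> rho d \in K.
  by move/revK; rewrite -phiK face_permE rev_dartK.
have tailK d d' : tail d = tail d' -> d \in K -> d' \in K.
  move=> tdd' dK; have : d' \in porbit rho d by rewrite rotG inE tdd'.
  case/porbitP=> i ->; elim: i => [|i IHi]; first by rewrite perm1.
  by rewrite expgSr permM rhoK.
(* The vertices with a dart in K are stable under adjacency, and all the darts
   at such a vertex are in K. *)
pose atK v := [exists d, (tail d == v) && (d \in K)].
have atK_adj u v : adj u v -> atK u -> atK v.
  move=> /adj_dart[d du dv] /existsP[d' /andP[/eqP d'u d'K]].
  apply/existsP; exists (rev_dart d); rewrite dv eqxx revK //.
  by apply: tailK d'K; rewrite d'u.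
have /(connect_invariant (f := atK)) inv := conG (tail d1) (tail d2).
have /existsP[d /andP[/eqP dt dK]] : atK (tail d2).
  rewrite -inv; first by apply/existsP; exists d1; rewrite eqxx.
  by move=> u v uv; apply/idP/idP; apply: atK_adj; rewrite // adj_sym.
exact: tailK dK.
Qed.

(** The boundary of a region enters and leaves a vertex v equally often: the
    face permutation maps the darts of K ending at v onto those starting at v,
    and reversal exchanges the darts of K with both sides in the region.  So a
    boundary dart can always be continued. *)
Lemma boundary_next d : d \in bd ->
  exists2 d', d' \in bd & tail d' = tail (rev_dart d).
Proof.
rewrite inE => /andP[dK rdK]; set v := tail (rev_dart d).
pose A := [set d' in K | tail d' == v];
  pose B := [set d' in K | tail (rev_dart d') == v].
have cardAB : #|A| = #|B|.
  rewrite -(card_preimset A (@perm_inj _ phi)); apply: eq_card => d'.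
  by rewrite !inE phiK tail_face_perm.
have [/existsP[d' /andP[d'b /eqP]]|/existsPn noNext] :=
    boolP [exists d', (d' \in bd) && (tail d' == v)]; first by exists d'.
have sAB : A \subset rev_dart (G:=G) @^-1: B.
  apply/subsetP => d'; rewrite !inE rev_dartK => /andP[d'K d'v];
    rewrite d'v andbT.
  by have := noNext d'; rewrite !inE d'K d'v andbT /= negbK.
have /eqP eqAB : A == rev_dart (G:=G) @^-1: B.
  by rewrite eqEcard sAB card_preimset ?cardAB ?leqnn //;
    apply: (inv_inj (@rev_dartK G)).
have : rev_dart d \in A by rewrite eqAB !inE rev_dartK dK /=.
by rewrite inE (negbTE rdK).
Qed.

(** Four successive boundary darts are distinct: two consecutive ones are never
    the reverse of each other, and the colours of their tails alternate. *)
Lemma boundary_ge4 d1 d2 : d1 \in K -> d2 \notin K -> 4 <= #|bd|.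
Proof.
move=> d1K d2K; have [e0 e0b] := boundary_neq0 d1K d2K.
have [e1 e1b t1] := boundary_next e0b.
have [e2 e2b t2] := boundary_next e1b.
have [e3 e3b t3] := boundary_next e2b.
have noback d d' : d \in bd -> d' \in bd -> tail d' = tail (rev_dart d) ->
    tail (rev_dart d') != tail d.
  rewrite !inE => /andP[dK rdK] /andP[d'K _] tt; apply: contraNneq rdK => hh.
  by rewrite -(@dart_eq d' (rev_dart d)) // rev_dartK.
have c1 : c (tail e1) = ~~ c (tail e0) by rewrite t1 color_rev.
have c2 : c (tail e2) = c (tail e0) by rewrite t2 color_rev c1 negbK.
have c3 : c (tail e3) = ~~ c (tail e0) by rewrite t3 color_rev c2.
have n02 : e0 != e2.
  by apply: contraNneq (noback _ _ e0b e1b t1) => ->; rewrite t2.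
have n13 : e1 != e3.
  by apply: contraNneq (noback _ _ e1b e2b t2) => ->; rewrite t3.
have nc d d' : c (tail d) = ~~ c (tail d') -> d != d'.
  by move=> cc; apply/eqP => dd; move: cc; rewrite dd; case: c.
have U : uniq [:: e0; e1; e2; e3].
  by rewrite /= !inE !negb_or n02 n13 !nc // ?c1 ?c2 ?c3 ?negbK.
have /card_uniqP/esym/eqP := U; rewrite eqn_leq => /andP[/leq_trans->//].
apply: subset_leq_card; apply/subsetP => d.
by rewrite !(@in_cons (dart G)) in_nil => /or4P[/eqP->|/eqP->|/eqP->|];
  rewrite ?orbF => // /eqP->.
Qed.

End Boundary.

Section Subgraph.
Variable S : {set G}.
Hypothesis S_neq0 : S != set0.
Let W := ~: darts_in S.
Let C := [set d in W | c (tail d)].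

Lemma rev_outside d : (rev_dart d \in W) = (d \in W).
Proof. by rewrite !inE rev_dartK andbC. Qed.

(** The equivalence generated by this relation is that of lying on the same face
    of the subgraph spanned by S, as the edges not inside S are erased.  As
    the relation is on darts, the root of a class is a dart, whose face serves
    as the representative of the class. *)
Definition merged : rel (dart G) :=
  fun d d' =>
    (porbit phi d == porbit phi d') || (d \in W) && (d' == rev_dart d).

Lemma merged_sym : connect_sym merged.
Proof.
apply: sym_connect_sym => d d'; rewrite /merged eq_sym; congr (_ || _).
apply/andP/andP => -[dW /eqP dd]; first by rewrite dd rev_outside dW rev_dartK.
by rewrite dd rev_outside dW rev_dartK.
Qed.

Local Notation cls := (fingraph.root merged).
Let R := [set d | cls d == d].

Lemma cls_merged d d' : merged d d' -> cls d = cls d'.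
Proof. by move/connect1/(fingraph.rootP merged_sym). Qed.

(** The two orthogonal families of functions on C are the coboundaries p of the
    vertices outside S and the coboundaries q, in the dual graph, of the faces
    outside a system R of representatives of the classes.  Both are independent:
    a vertex potential which vanishes on S and has no difference along C is
    constant as G is connected, and a face potential which has no difference
    across C is constant on each class. *)
Lemma card_outside : (#|G| - #|S|) + (#|porbits phi| - #|R|) <= #|C|.
Proof.
have <- : #|~: S| = #|G| - #|S| by rewrite -(cardsC S) addKn.
pose B := porbits phi :\: [set porbit phi d | d in R].
apply: leq_trans (_ : #|~: S| + #|B| <= _).
  rewrite leq_add2l cardsD leq_sub2l //.
  by apply: leq_trans (subset_leq_card (subsetIr _ _)) (leq_imset_card _ _).
pose p v d : rat := ((tail (rev_dart d) == v)%:R - (tail d == v)%:R)%R.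
pose q f d : rat :=
  ((porbit phi d == f)%:R - (porbit phi (rev_dart d) == f)%:R)%R.
have sum_ind (T : finType) (x : T -> rat) a b :
    (\sum_i x i * ((a == i)%:R - (b == i)%:R))%R = (x a - x b)%R.
  under eq_bigr do rewrite mulrBr.
  rewrite sumrB (bigD1 a) //= eqxx mulr1 big1 ?addr0; last first.
    by move=> i ia; rewrite eq_sym (negbTE ia) mulr0.
  rewrite (bigD1 b) //= eqxx mulr1 big1 ?addr0 //.
  by move=> i ib; rewrite eq_sym (negbTE ib) mulr0.
apply: (free_families_le (p := p) (q := q)).
- move=> x x_out x_eq v.
  have x_adj u w : adj u w -> x u = x w.
    move=> /adj_dart[d <- <-].
    have x_C d' : d' \in C -> x (tail d') = x (tail (rev_dart d')).
      by move/x_eq; rewrite sum_ind => /eqP; rewrite subr_eq0 => /eqP.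
    have [dW|] := boolP (d \in W).
      have [cd|cd] := boolP (c (tail d)); first by rewrite x_C // inE dW.
      by rewrite -{1}(rev_dartK d) -x_C // inE rev_outside dW color_rev.
    by rewrite !inE negbK => /andP[tS hS]; rewrite !x_out ?inE ?negbK.
  have /set0Pn[s sS] := S_neq0.
  by rewrite (connect_invariant x_adj (conG v s)) x_out // inE negbK.
- move=> y y_out y_eq f.
  have y_C d : d \in C -> y (porbit phi d) = y (porbit phi (rev_dart d)).
    by move/y_eq; rewrite sum_ind => /eqP; rewrite subr_eq0 => /eqP.
  have y_merged d d' : merged d d' -> y (porbit phi d) = y (porbit phi d').
    case/orP => [/eqP->//|/andP[dW /eqP->]].
    have [cd|cd] := boolP (c (tail d)); first by rewrite y_C // inE dW.
    by rewrite -{1}(rev_dartK d) -y_C // inE rev_outside dW color_rev.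
  have [|/y_out//] := boolP (f \in B); rewrite !inE => /andP[_ /imsetP[d _ ->]].
  rewrite (connect_invariant y_merged (connect_root merged d)) y_out //.
  by rewrite inE negb_and negbK imset_f // inE root_root //; apply: merged_sym.
- move=> v f; rewrite inE => vS fB.
  pose u d : rat := (p v d * (porbit phi d == f)%:R)%R.
  transitivity (\sum_(d in W) u d)%R.
    rewrite (big_rev_color _ _ rev_outside); apply: eq_bigr => d _.
    by rewrite /u /p /q rev_dartK mulrBr -(opprB (tail d == v)%:R)%R mulNr
      mulNr -mulrN opprK.
  transitivity (\sum_d u d)%R.
    rewrite [RHS](bigID [in W]) /= [X in (_ + X)%R]big1 ?addr0 // => d.
    rewrite !inE negbK => /andP[tS hS]; rewrite /u /p.
    have nv w : w \in S -> (w == v) = false.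
      by move=> wS; apply/negP => /eqP wv; rewrite -wv wS in vS.
    by rewrite !nv // subrr mul0r.
  (* The head of a dart is the tail of the next one on the same face, so the sum
     telescopes along each face. *)
  pose g d : rat := ((tail d == v)%:R * (porbit phi d == f)%:R)%R.
  transitivity (\sum_d (g (phi d) - g d))%R.
    apply: eq_bigr => d _; rewrite /u /p /g mulrBl tail_face_perm.
    by rewrite (porbit_perm phi 1 d).
  by apply/eqP; rewrite sumrB subr_eq0 eq_sym (reindex_inj (@perm_inj _ phi)).
Qed.

(** When there is another class, a class has at least four boundary darts, and
    these lie inside S, otherwise the class would extend across them. *)
Lemma card_classes : 1 < #|R| -> 4 * #|R| <= #|darts_in S|.
Proof.
move=> R_gt1; rewrite -[X in _ <= X]sum1_card (partition_big cls (mem R)) /=;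
    last first.
  by move=> d _; rewrite inE root_root //; apply: merged_sym.
rewrite mulnC -sum_nat_const; apply: leq_sum => r rR.
have phi_cls d : cls (phi d) = cls d.
  by apply/esym/cls_merged/orP; left; rewrite (porbit_perm phi 1 d).
have [r' r'R nrr'] : exists2 r', r' \in R & r' != r.
  have /card_gt0P[r'] : 0 < #|R :\ r| by move: R_gt1; rewrite (cardsD1 r) rR.
  by rewrite !inE => /andP[nr r'R]; exists r'; rewrite ?inE.
have := @boundary_ge4 [set d | cls d == r] _ r r'.
move=> /(_ _ _ _)/leq_trans; apply.
- by move=> d; rewrite !inE phi_cls.
- by move: rR; rewrite !inE.
- by move: r'R; rewrite !inE => /eqP->.
rewrite sum1_card; apply: subset_leq_card; apply/subsetP => d.
case/setIdP; rewrite inE => dr; rewrite inE => rdr;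
  rewrite unfold_in /= dr andbT.
apply: contraR rdr => dW.
by rewrite -(eqP dr) eq_sym; apply/eqP/cls_merged;
  rewrite /merged inE dW eqxx orbT.
Qed.

End Subgraph.
End Rotation.

Lemma card_arcs_quadrangulation :
  quadrangulation G -> #|arcs_in [set: G]| + 8 = 4 * #|G|.
Proof.
case=> _ _ [rho [_ euler] face4].
have arith n F e D : n + F = e + 2 -> D = e * 2 -> D = F * 4 -> D + 8 = 4 * n
  by lia.
rewrite -card_dart; apply: arith euler card_dart_edges _.
by apply: card_porbits_uniform => f /face4[].
Qed.

Lemma sparse_bipartite_plane (rho : {perm dart G}) S :
  bipartite G -> connected G -> is_plane_embedding rho ->
  #|arcs_in S| <= 2 * (2 * #|S|).
Proof.
case=> [c colG] conG [rotG euler].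
have [->|S0] := eqVneq S set0.
  by rewrite (_ : arcs_in _ = set0) ?cards0 //; apply/setP => p; rewrite !inE.
have arith n F e C s r a : n + F = e + 2 -> a + 2 * C = e * 2 ->
    (n - s) + (F - r) <= C -> (1 < r -> 4 * r <= a) -> 0 < s <= n ->
  a <= 2 * (2 * s).
  by move=> ? ? ? r4 /andP[? ?]; case: (ltnP 1 r) => [/r4|]; lia.
rewrite -card_darts_in.
apply: arith euler _ (card_outside conG rotG colG S0) _ _.
- rewrite -card_dart_edges -(cardsC (darts_in S)); congr (_ + _).
  rewrite -[RHS]sum1_card (big_rev_color colG _ _ (@rev_outside S)) /=.
  by rewrite sum_nat_const mulnC.
- exact: (card_classes conG rotG colG (S := S)).
- by rewrite card_gt0 S0 max_card.
Qed.

End PlaneMaps.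

(** * Recognizing and orienting the cube *)

Definition bits : finType := (bool * bool * bool)%type.

Definition bits_adj (x y : bits) :=
  (x.1.1 (+) y.1.1) + (x.1.2 (+) y.1.2) + (x.2 (+) y.2) == 1.

Lemma big_bits (F : bits -> nat) :
  \sum_x F x = \sum_(a : bool) \sum_(b : bool) \sum_(c : bool) F (a, b, c).
Proof. by rewrite !pair_bigA; apply: eq_bigr => -[[a b] c]. Qed.

(** Triples of booleans compute, so that adjacency in the cube can be checked by
    case analysis. *)
Lemma isomorphic_Q3P (G : sgraph) :
  isomorphic G Q3 <->
  exists2 f : G -> bits, bijective f &
    forall u v, bits_adj (f u) (f v) = adj u v.
Proof.
pose i1 : 'I_3 := lift ord0 ord0; pose i2 : 'I_3 := lift ord0 (lift ord0 ord0).
pose to_bits (x : Q3) : bits := (x ord0, x i1, x i2).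
pose of_bits (b : bits) : Q3 :=
  [ffun i : 'I_3 => nth false [:: b.1.1; b.1.2; b.2] i].
have to_bitsK : cancel to_bits of_bits.
  by move=> x; apply/ffunP => -[[|[|[|//]]] i]; rewrite ffunE; congr (x _);
    apply: val_inj.
have of_bitsK : cancel of_bits to_bits.
  by move=> [[a b] c]; rewrite /to_bits !ffunE.
have adj_bits x y : bits_adj (to_bits x) (to_bits y) = adj x y.
  rewrite [RHS]/= /cube_adj -sum1dep_card big_mkcond !big_ord_recl big_ord0 /=.
  rewrite /bits_adj /= addnA.
  by congr (_ + _ + _ == 1); case: (x _); case: (y _).
split=> [[f bijf adjf]|[f bijf adjf]].
  exists (to_bits \o f) => [|u v]; last by rewrite adj_bits.
  by apply: bij_comp bijf; exists of_bits.
exists (of_bits \o f) => [|u v]; last by rewrite -adj_bits !of_bitsK.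
by apply: bij_comp bijf; exists to_bits.
Qed.

Section CubeRecognition.
Variable G : sgraph.
Implicit Types (u v w : G).

(** Each vertex outside I has exactly one non-neighbour in I, its mate, and
    distinct vertices outside I have distinct mates.  Sending the vertices of I
    to the odd vectors of the cube and every other vertex to the antipode of
    the image of its mate is an isomorphism, as an even vector and an odd one
    are adjacent unless they are antipodal. *)
Lemma cube_of_cubic_4_4 (I : {set G}) :
    #|I| = 4 -> #|~: I| = 4 -> (forall v, degree v = 3) ->
    (forall u v, adj u v -> (u \in I) != (v \in I)) ->
  isomorphic G Q3.
Proof.
move=> cardI cardJ deg3 cross; apply/isomorphic_Q3P.
have card_co (J : {set G}) v : #|J| = 4 -> (forall u, adj u v -> u \in J) ->
    #|[set u in J | ~~ adj u v]| = 1.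
  move=> cJ nJ; have := cardsID [set u | adj u v] J; rewrite cJ.
  have -> : J :&: [set u | adj u v] = [set u | adj u v].
    by apply/setIidPr/subsetP => u; rewrite inE; apply: nJ.
  have -> : J :\: [set u | adj u v] = [set u in J | ~~ adj u v].
    by apply/setP => u; rewrite !inE andbC.
  by have := deg3 v; rewrite /degree => -> [].
have nbrI v u : v \notin I -> adj u v -> u \in I.
  by move=> /negbTE vI /cross; rewrite vI; case: in_mem.
have nbrJ v u : v \in I -> adj u v -> u \in ~: I.
  by move=> vI /cross; rewrite vI inE; case: in_mem.
have /fin_all_exists[m mP] v : exists w, w \in I /\
    if v \in I then w = v else forall u, u \in I -> adj u v = (u != w).
  have [vI|vI] := boolP (v \in I); first by exists v.
  have /eqP/cards1P[w wE] := card_co I v cardI (nbrI v ^~ vI).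
  have inw u : (u \in I) && ~~ adj u v = (u == w).
    by move/setP/(_ u): wE; rewrite !inE.
  exists w; split; first by have := inw w; rewrite eqxx => /andP[].
  by move=> u uI; rewrite -inw uI negbK.
have mI v : m v \in I by case: (mP v).
have m_id v : v \in I -> m v = v by move=> vI; case: (mP v) => _; rewrite vI.
have m_adj u v : u \in I -> v \notin I -> adj u v = (u != m v).
  by move=> uI vI; case: (mP v) => _; rewrite (negbTE vI); apply.
have m_inj u v : (u \in I) = (v \in I) -> m u = m v -> u = v.
  case: (boolP (u \in I)) (boolP (v \in I)) => uI [] vI // _ muv.
    by rewrite -(m_id u uI) muv m_id.
  have /eqP/cards1P[w wE] := card_co (~: I) (m u) cardJ (nbrJ _ ^~ (mI u)).
  have inw x : x \notin I -> m x = m u -> x = w.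
    move=> xI mx; apply/set1P; rewrite -wE !inE xI -mx adj_sym m_adj //.
    by rewrite eqxx.
  by rewrite (inw u) // (inw v).
pose idx v := index (m v) (enum I).
have idx4 v : idx v < 4 by rewrite -cardI cardE index_mem mem_enum.
(* The even vectors are numbered by k < 4, and b tells whether to take the
   antipode. *)
pose code k b : bits :=
  (b (+) odd k, b (+) odd k./2, b (+) (odd k (+) odd k./2)).
have code_inj j k a b : j < 4 -> k < 4 -> code j a = code k b -> j = k /\ a = b.
  by case: j => [|[|[|[|//]]]]; case: k => [|[|[|[|//]]]]; case: a; case: b.
have code_adj j k a b : j < 4 -> k < 4 ->
    bits_adj (code j a) (code k b) = (a != b) && (j != k).
  by case: j => [|[|[|[|//]]]]; case: k => [|[|[|[|//]]]]; case: a; case: b.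
exists (fun v => code (idx v) (v \in I)) => [|u v].
  apply: inj_card_bij => [u v|];
    last by rewrite !card_prod card_bool -(cardsC I) cardI cardJ.
  case/code_inj => // eq_idx eqI; apply: m_inj => //.
  by apply: (@index_inj _ u (enum I)) eq_idx; rewrite mem_enum.
rewrite code_adj //.
have -> : (idx u != idx v) = (m u != m v).
  congr (~~ _); apply/eqP/eqP => [eq_idx|eq_m]; last by rewrite /idx eq_m.
  by apply: (@index_inj _ u (enum I)) eq_idx; rewrite mem_enum.
case: (boolP (u \in I)) (boolP (v \in I)) => uI [] vI /=.
- by apply/esym/negP => /cross; rewrite uI vI.
- by rewrite (m_id u) // m_adj.
- by rewrite (m_id v) // adj_sym m_adj // eq_sym.
- by apply/esym/negP => /cross; rewrite (negbTE uI) (negbTE vI).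
Qed.

(** Counting the edges leaving I, the set of vertices of indegree 2, as sketched
    at the top, leaves no slack: the sum [z] of the degrees inside the
    complement of I vanishes and all the degrees equal 3. *)
Lemma cube_of_proper_2_orientation k :
    #|arcs_in [set: G]| + 8 = 4 * #|G| -> 3 <= min_degree G ->
    k <= 2 -> has_proper_orientation G k ->
  isomorphic G Q3.
Proof.
move=> cardA mindeg k2.
case/existsP=> o /andP[/andP[ori /forallP le_k] /forallP prop].
have ge3 := min_degreeP mindeg.
have sum_const n : \sum_(v : G) n = n * #|G| by rewrite sum_nat_const mulnC.
pose I := [set v | indegree o v == 2].
have indepI u v : u \in I -> v \in I -> adj u v = false.
  rewrite !inE => /eqP du /eqP dv; apply/negP => uv.
  by have := prop u => /forallP/(_ v); rewrite uv du dv.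
have cardIJ : #|I| + #|~: I| = #|G| by rewrite cardsC.
have cardJ : #|~: I| <= 4.
  have : \sum_v (indegree o v + (v \in ~: I)) <= \sum_(v : G) 2.
    apply: leq_sum => v _; rewrite !inE; have := le_k v.
    by case: eqP => /= [->//|]; lia.
  have sumJ : \sum_v (v \in ~: I : nat) = #|~: I|.
    by rewrite -sum1_card [RHS]big_mkcond; apply: eq_bigr => v _; case: in_mem.
  rewrite big_split /= sum_const sumJ; have := sum_indegree ori; lia.
pose x := \sum_(v in I) degree v; pose y := \sum_(v in ~: I) degree v.
pose cr := \sum_(v in ~: I) \sum_(u in I) adj u v.
pose z := \sum_(v in ~: I) \sum_(u in ~: I) adj u v.
have xE : x = cr.
  rewrite /x /cr exchange_big /=; apply: eq_bigr => v vI; rewrite degreeE.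
  rewrite (bigID [in I]) /= big1 => [|u uI]; last by rewrite indepI.
  by apply: eq_big => u; rewrite ?inE // adj_sym.
have yE : y = cr + z.
  rewrite /y /cr /z -big_split /=; apply: eq_bigr => v _; rewrite degreeE.
  by rewrite (bigID [in I]) /=; congr (_ + _); apply: eq_bigl => u;
    rewrite in_setC.
have xyE : x + y = #|arcs_in [set: G]|.
  rewrite -sum_degree (bigID [in I]) /=; congr (_ + _).
  by apply: eq_bigl => u; rewrite in_setC.
have xge : 3 * #|I| <= x by rewrite mulnC -sum_nat_const; apply: leq_sum.
have yge : 3 * #|~: I| <= y by rewrite mulnC -sum_nat_const; apply: leq_sum.
have [cI cJ] : #|I| = 4 /\ #|~: I| = 4 by lia.
have z0 : z = 0 by lia.
apply: (cube_of_cubic_4_4 cI cJ) => [v|u v uv].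
  apply/eqP; rewrite eqn_leq ge3 andbT leqNgt; apply/negP => gt3.
  have : \sum_(u : G) 3 < \sum_(u : G) degree u.
    rewrite (bigD1 v) // [in X in _ < X](bigD1 v) //= -addSn leq_add //.
    exact: leq_sum.
  rewrite sum_const sum_degree; lia.
have [uI|uI] := boolP (u \in I); have [vI|vI] := boolP (v \in I) => //.
  by rewrite indepI in uv.
have /eqP := z0; rewrite /z sum_nat_eq0 => /forall_inP/(_ v);
  rewrite inE vI => /(_ isT).
by rewrite sum_nat_eq0 => /forall_inP/(_ u); rewrite inE uI uv => /(_ isT).
Qed.

(** Edges along the first coordinate go from even to odd vectors and the others
    from odd to even ones, so even vectors have indegree 2 and odd ones 1. *)
Lemma proper_2_orientation_of_cube :
  isomorphic G Q3 -> has_proper_orientation G 2.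
Proof.
case/isomorphic_Q3P => f bijf adjf.
pose odd_bits (x : bits) := x.1.1 (+) x.1.2 (+) x.2.
pose arc (x y : bits) := bits_adj x y && (odd_bits x (+) (x.1.1 (+) y.1.1)).
pose o := [set p : G * G | arc (f p.1) (f p.2)].
have degE v : indegree o v = 2 - odd_bits (f v).
  rewrite indegreeE (eq_bigr (fun u => arc (f u) (f v) : nat)) => [|u _];
    last by rewrite inE.
  rewrite -(reindex f (P := predT)
    (F := fun x => arc x (f v) : nat)) ?big_bits; last exact: onW_bij.
  by rewrite !big_bool; case: (f v) => [[[] []] []].
apply/existsP; exists o; apply/andP; split; first apply/andP; first split.
- apply/forallP => u; apply/forallP => v; rewrite !inE /= -adjf.
  by case: (f u) (f v) => [[[] []] []] [[[] []] []].
- by apply/forallP => v; rewrite degE leq_subr.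
- apply/forallP => u; apply/forallP => v; rewrite !degE -adjf.
  by case: (f u) (f v) => [[[] []] []] [[[] []] []].
Qed.

Lemma card_cube : isomorphic G Q3 -> #|G| = 8.
Proof.
by case/isomorphic_Q3P => f /bij_eq_card -> _; rewrite !card_prod card_bool.
Qed.

Lemma arcs_le_orientation k (o : {set G * G}) :
  is_k_orientation k o -> #|arcs_in [set: G]| <= 2 * (k * #|G|).
Proof.
case/andP=> ori /forallP le_k; rewrite -(sum_indegree ori) leq_pmul2l //.
by rewrite mulnC -sum_nat_const; apply: leq_sum.
Qed.

End CubeRecognition.

Theorem theorem5 (G : sgraph) (quadG : quadrangulation G)
    (minG : 3 <= min_degree G) :
  (~ isomorphic G Q3 -> proper_orientation_number G = 3) /\
  (isomorphic G Q3 -> proper_orientation_number G = 2).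
Proof.
have cardA := card_arcs_quadrangulation quadG.
rewrite /proper_orientation_number; case: ex_minnP => k has_k min_k.
have k2 : k <= 2 -> isomorphic G Q3.
  by move=> k2; apply: cube_of_proper_2_orientation has_k.
split=> [notQ3|isoQ3]; apply/eqP; rewrite eqn_leq; apply/andP; split.
- have [bipG conG [rho planeG _]] := quadG; apply: min_k.
  apply: proper_orientation_of_bipartite => //;
    apply: orientation_of_sparse => S.
  exact: sparse_bipartite_plane planeG.
- by rewrite ltnNge; apply/negP => /k2.
- exact/min_k/proper_2_orientation_of_cube.
- have /existsP[o /andP[ok _]] := has_k.
  have := arcs_le_orientation ok; move: cardA; rewrite (card_cube isoQ3); lia.
Qed.
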